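(* Let $0<\alpha<1$ and let $f(z)=\sum_{n=0}^\infty a_n z^n$ be a function in the class $\mathcal{B}$. Then $$\sum_{n=0}^\infty \frac{\Gamma(n+1)}{\Gamma(n+\alpha+1)}\,|a_n|\, r^{n+\alpha} \;\le\; \frac{r^{\alpha}}{\Gamma(1+\alpha)}\qquad\text{for all } 0< r\le R_\alpha^{\mathrm{int}},$$ where $R_\alpha^{\mathrm{int}}$ is the minimum positive root $r\in(0,1)$ of $$\sum_{n=1}^\infty \frac{\Gamma(n+1)}{\Gamma(n+\alpha+1)}\, r^n = \frac{1}{2\,\Gamma(1+\alpha)}.$$
   Context: $\mathbb{D}=\{z\in\mathbb{C}:|z|<1\}$. $\mathcal{B}$ denotes the class of analytic functions $f(z)=\sum_{n=0}^\infty a_nz^n$ in $\mathbb{D}$ such that $|f(z)|<1$ for all $z\in\mathbb{D}$. $\Gamma$ is the Gamma function. The left-hand side is the majorant series (Bohr sum) of the Riemann–Liouville fractional integral $I^\alpha f(z)=\sum_{n=0}^\infty a_n\frac{\Gamma(n+1)}{\Gamma(n+\alpha+1)}z^{n+\alpha}$, with $r=|z|$. *)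

(* Defs.v *)
From Stdlib Require Import Reals.
From Coquelicot Require Import Coquelicot.
Open Scope R_scope.

(* Euler's integral, improper at both endpoints; meaningful for [0 < x].
   [Rpower t (x - 1)] is only integrated over [0 < t], where it is t^(x-1). *)
Definition Gamma (x : R) : R :=
  RInt_gen (fun t : R => Rpower t (x - 1) * exp (- t))
           (at_right 0) (Rbar_locally p_infty).

(* [f] belongs to the class B and [a] is the sequence of its Taylor
   coefficients at 0: f(z) = sum a_n z^n and |f(z)| < 1 on the open unit disk.
   The values of [f] outside the disk are irrelevant. *)
Definition in_class_B (f : C -> C) (a : nat -> C) : Prop :=
  forall z : C, Cmod z < 1 ->
    is_pseries (K := C_AbsRing) (V := C_NormedModule) a z (f z) /\
    Cmod (f z) < 1.

Definition frac_coef (alpha : R) (n : nat) : R :=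
  Gamma (INR n + 1) / Gamma (INR n + alpha + 1).

(* [is_series] starts at index 0, hence the shift by [S] for a sum over n >= 1. *)
Definition is_radius_root (alpha r : R) : Prop :=
  0 < r < 1 /\
  is_series (fun n : nat => frac_coef alpha (S n) * r ^ S n)
            (1 / (2 * Gamma (1 + alpha))).

Definition is_radius_int (alpha Rint : R) : Prop :=
  is_radius_root alpha Rint /\
  forall s : R, is_radius_root alpha s -> Rint <= s.

(* Main.v *)
(* Write c_n = Gamma(n+1)/Gamma(n+alpha+1). Since Gamma(x+1) = x Gamma(x), the c_n are
   positive and decreasing with c_0 = 1/Gamma(1+alpha). The root exists because
   c_1 r + c_2 r^2 > c_0/2 already at r = 9/10, and up to the root the sum over n >= 1 of
   c_n r^n is at most c_0/2. Wiener's inequality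
   |a_n| <= 1 - |a_0|^2 then bounds the Bohr sum, up to the factor r^alpha, by
   c_0 (|a_0| + (1 - |a_0|^2)/2) <= c_0.

   Wiener's inequality: multiplication by f is a contraction in the mean square on circles.
   With s = 1 - |a_0|^2, b = a_n rho^n, e = (z/rho)^n, test it on u = s + conj(a_0) b e,
   chosen so that v = a_0 s + b e consists of the terms of f u of degree 0 and n; then
   mean |v|^2 <= mean |u|^2 reads |a_0|^2 s^2 + |b|^2 <= s^2 + |a_0|^2 |b|^2, that is
   |b| <= s. Means are taken over N-th roots of unity and f is replaced by a partial sum of
   degree less than N - n, for which these means are exact. *)
Require Import Defs.
From Stdlib Require Import ZArith Reals Ranalysis5 Lra Lia.
From Coquelicot Require Import Coquelicot.
Open Scope R_scope.

(** * The Gamma function on [1, +oo) *)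

Lemma exp_monotone (x y : R) : x <= y -> exp x <= exp y.
Proof.
  intros [H | ->]; [left; now apply exp_increasing | apply Rle_refl].
Qed.

Lemma ex_RInt_pos (f : R -> R) (x y : R) :
  (forall t, 0 < t -> continuous f t) -> 0 < x -> 0 < y -> ex_RInt f x y.
Proof.
  intros Hf Hx Hy; apply (ex_RInt_continuous (V := R_CompleteNormedModule)).
  intros z [Hz _]; apply Hf; revert Hz; apply Rlt_le_trans.
  now apply Rmin_glb_lt.
Qed.

(** Integrals of a nonnegative function grow with the interval, so their supremum is the improper
    integral. The bound by [l] is kept in the conclusion because it later yields the positivity of
    [Gamma]. *)
Lemma is_RInt_gen_nonneg (f : R -> R) (B : R) :
  (forall t, 0 < t -> continuous f t) ->
  (forall t, 0 < t -> 0 <= f t) ->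
  (forall x y, 0 < x < y -> RInt f x y <= B) ->
  exists l, is_RInt_gen f (at_right 0) (Rbar_locally p_infty) l /\
    forall x y, 0 < x < y -> RInt f x y <= l.
Proof.
  intros Hc Hp HB.
  destruct (completeness (fun v => exists x y, 0 < x < y /\ v = RInt f x y))
    as [l [Hub Hlub]].
  - exists B; intros v (x & y & Hxy & ->); now apply HB.
  - exists (RInt f 1 2), 1, 2; split; [lra | easy].
  - assert (Hl : forall x y, 0 < x < y -> RInt f x y <= l).
    { intros x y Hxy; apply Hub; now exists x, y. }
    exists l; split; [| exact Hl].
    intros P [eps HP].
    assert (Hex : exists x y, 0 < x < y /\ l - eps < RInt f x y).
    { apply Classical_Prop.NNPP; intros Hn.
      assert (l <= l - eps).
      { apply Hlub; intros v (x & y & Hxy & ->).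
        apply Rnot_lt_le; intros Hlt; apply Hn; now exists x, y. }
      pose proof (cond_pos eps); lra. }
    destruct Hex as (x & y & Hxy & Hlt).
    (* For such [u] and [v] the interval contains [x, y], so its integral lies between [l - eps] and
       [l]. *)
    apply (Filter_prod _ _ _ (fun u => 0 < u < x) (fun v => y < v)).
    + assert (Hx0 : 0 < x) by lra.
      exists (mkposreal x Hx0); intros u Hu Hu0.
      unfold ball in Hu; simpl in Hu; unfold AbsRing_ball, abs, minus, plus, opp in Hu;
        simpl in Hu.
      rewrite Ropp_0, Rplus_0_r, Rabs_pos_eq in Hu by lra; lra.
    + now exists y.
    + intros u v Hu Hv; exists (RInt f u v); simpl; split.
      * apply (RInt_correct (V := R_CompleteNormedModule)).
        apply ex_RInt_pos; [easy | lra | lra].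
      * apply HP.
        assert (HC : RInt f u v = RInt f u x + (RInt f x y + RInt f y v)).
        { rewrite <- (RInt_Chasles (V := R_CompleteNormedModule) f u x v),
            <- (RInt_Chasles (V := R_CompleteNormedModule) f x y v);
            [easy | apply ex_RInt_pos; (easy || lra) ..]. }
        assert (0 <= RInt f u x).
        { apply RInt_ge_0; [lra | apply ex_RInt_pos; (easy || lra) |].
          intros t Ht; apply Hp; lra. }
        assert (0 <= RInt f y v).
        { apply RInt_ge_0; [lra | apply ex_RInt_pos; (easy || lra) |].
          intros t Ht; apply Hp; lra. }
        assert (RInt f u v <= l) by (apply Hl; lra).
        unfold ball; simpl; unfold AbsRing_ball, abs, minus, plus, opp; simpl.
        apply Rabs_def1; pose proof (cond_pos eps); lra.
Qed.

Lemma continuous_gamma_kernel (y t : R) :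
  0 < t -> continuous (fun t : R => Rpower t y * exp (- t)) t.
Proof.
  intros Ht; apply (ex_derive_continuous (K := R_AbsRing) (V := R_NormedModule)); unfold Rpower.
  auto_derive; lra.
Qed.

(** Half of the exponential decay absorbs the power: ln(ct) <= ct - 1 bounds y ln t by y c t plus a
    constant, and the slope y c is at most 1/2. *)
Lemma gamma_kernel_bound (y : R) :
  0 <= y ->
  exists K, 0 < K /\
    forall t, 0 < t -> Rpower t y * exp (- t) <= K * exp (- t / 2).
Proof.
  (* Dividing by y + 1 rather than y covers y = 0. *)
  intros Hy; set (c := / (2 * (y + 1))).
  assert (Hc : 0 < c) by (apply Rinv_0_lt_compat; lra).
  assert (Hyc : y * c <= 1 / 2).
  { unfold c; apply Rmult_le_reg_r with (2 * (y + 1)); [lra |].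
    field_simplify; lra. }
  exists (exp (y * (- 1 - ln c))); split; [apply exp_pos |].
  intros t Ht; unfold Rpower; rewrite <- !exp_plus; apply exp_monotone.
  assert (Hln : 1 + (ln c + ln t) <= c * t).
  { rewrite <- ln_mult by lra.
    rewrite <- (exp_ln (c * t)) at 2 by nra; apply exp_ineq1_le. }
  assert (y * ln t <= y * (c * t - 1 - ln c)) by (apply Rmult_le_compat_l; lra).
  assert (y * c * t <= 1 / 2 * t) by (apply Rmult_le_compat_r; lra).
  nra.
Qed.

Lemma RInt_exp_half (K x y : R) :
  0 < x < y ->
  RInt (fun t => K * exp (- t / 2)) x y = 2 * K * (exp (- x / 2) - exp (- y / 2)).
Proof.
  intros Hxy; apply is_RInt_unique.
  replace (2 * K * (exp (- x / 2) - exp (- y / 2)))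
    with (minus (- 2 * K * exp (- y / 2)) (- 2 * K * exp (- x / 2)))
    by (unfold minus, plus, opp; simpl; ring).
  apply (is_RInt_derive (V := R_CompleteNormedModule) (fun t => - 2 * K * exp (- t / 2))).
  - intros t _; auto_derive; [easy |]. unfold Rdiv; field.
  - intros t _; apply (ex_derive_continuous (K := R_AbsRing) (V := R_NormedModule)); auto_derive; easy.
Qed.

(** The kernel is dominated by K exp(-t/2), whose integrals over subintervals of (0, oo) stay below
    2K. Positivity comes from the integral over [1, 2]. *)
Lemma is_RInt_gen_Gamma (x : R) :
  1 <= x ->
  is_RInt_gen (fun t : R => Rpower t (x - 1) * exp (- t))
    (at_right 0) (Rbar_locally p_infty) (Gamma x) /\ 0 < Gamma x.
Proof.
  intros Hx.
  destruct (gamma_kernel_bound (x - 1)) as (K & HK & Hb); [lra |].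
  set (f := fun t : R => Rpower t (x - 1) * exp (- t)) in *.
  assert (Hpos : forall t, 0 < f t).
  { intros t; unfold f, Rpower; apply Rmult_lt_0_compat; apply exp_pos. }
  assert (Hc : forall t, 0 < t -> continuous f t).
  { intros t; apply continuous_gamma_kernel. }
  destruct (is_RInt_gen_nonneg f (2 * K)) as (l & Hl & Hle); [easy | | |].
  - intros t _; now left.
  - intros a b Hab.
    apply Rle_trans with (RInt (fun t => K * exp (- t / 2)) a b).
    + apply RInt_le; [lra | apply ex_RInt_pos; (easy || lra) | |].
      * apply ex_RInt_pos; [| lra | lra].
        intros t _; apply (ex_derive_continuous (K := R_AbsRing) (V := R_NormedModule)); auto_derive; easy.
      * intros t Ht; apply Hb; lra.
    + rewrite RInt_exp_half by easy.
      pose proof (exp_pos (- b / 2)).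
      assert (exp (- a / 2) <= 1) by (rewrite <- exp_0; apply exp_monotone; lra).
      nra.
  - replace (Gamma x) with l.
    + split; [exact Hl |].
      apply Rlt_le_trans with (RInt f 1 2); [| apply Hle; lra].
      apply RInt_gt_0; [lra | easy |].
      intros t Ht; apply Hc; lra.
    + symmetry; unfold Gamma; apply is_RInt_gen_unique; [typeclasses eauto .. | exact Hl].
Qed.

Lemma Gamma_pos (x : R) : 1 <= x -> 0 < Gamma x.
Proof. intros Hx; now apply is_RInt_gen_Gamma. Qed.

(** The fundamental theorem applies on [u, v] once both endpoints are positive, which holds
    eventually for the product filter; then the limits of F are taken at both ends. *)
Lemma is_RInt_gen_antiderivative (F f : R -> R) (la lb : R) :
  (forall t, 0 < t -> is_derive F t (f t)) ->
  (forall t, 0 < t -> continuous f t) ->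
  filterlim F (at_right 0) (locally la) ->
  filterlim F (Rbar_locally p_infty) (locally lb) ->
  is_RInt_gen f (at_right 0) (Rbar_locally p_infty) (lb - la).
Proof.
  intros HF Hf Ha Hb P HP.
  assert (Hlim : filterlim (fun ab : R * R => minus (F (snd ab)) (F (fst ab)))
            (filter_prod (at_right 0) (Rbar_locally p_infty)) (locally (lb - la))).
  { refine (filterlim_comp_2 (fun ab : R * R => F (snd ab)) (fun ab => opp (F (fst ab)))
      plus (G := locally lb) (H := locally (opp la)) _ _ _).
    - refine (filterlim_comp (R * R) R R snd F _ _ _ _ Hb); apply filterlim_snd.
    - refine (filterlim_comp (R * R) R R (fun ab => F (fst ab)) opp _ (locally la) _ _ _).
      + refine (filterlim_comp (R * R) R R fst F _ _ _ _ Ha); apply filterlim_fst.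
      + apply (filterlim_opp (V := R_NormedModule)).
    - apply (filterlim_plus (V := R_NormedModule)). }
  assert (Hpos : filter_prod (at_right 0) (Rbar_locally p_infty)
                   (fun ab => 0 < fst ab /\ 0 < snd ab)).
  { apply (Filter_prod _ _ _ (fun u => 0 < u) (fun v => 0 < v)); [| now exists 0 | easy].
    now exists (mkposreal 1 Rlt_0_1). }
  assert (HlimP : filter_prod (at_right 0) (Rbar_locally p_infty)
                    (fun ab => P (minus (F (snd ab)) (F (fst ab)))))
    by exact (Hlim P HP).
  refine (filter_imp _ _ _ (filter_and _ _ HlimP Hpos)).
  intros [u v] [HPuv [Hu Hv]]; simpl in *.
  exists (minus (F v) (F u)); split; [| exact HPuv].
  apply (is_RInt_derive (V := R_CompleteNormedModule));
    intros t [Ht _]; (apply HF || apply Hf); revert Ht; apply Rlt_le_trans;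
    now apply Rmin_glb_lt.
Qed.

Lemma filterlim_exp_half_p_infty (K : R) :
  filterlim (fun t => K * exp (- t / 2)) (Rbar_locally p_infty) (locally 0).
Proof.
  replace 0 with (K * 0) by ring.
  apply filterlim_comp with (G := locally 0).
  - eapply filterlim_comp; [| exact is_lim_exp_m].
    intros P [M HM]; exists (- 2 * M); intros t Ht; apply HM; lra.
  - apply (filterlim_scal_r (V := R_NormedModule) K 0).
Qed.

(** For 0 < t < 1 and x >= 1 the function is squeezed between 0 and t. *)
Lemma gamma_boundary_0 (x : R) :
  1 <= x -> filterlim (fun t => Rpower t x * exp (- t)) (at_right 0) (locally 0).
Proof.
  intros Hx; apply (filterlim_le_le (fun _ => 0) _ (fun t => t) 0).
  - exists (mkposreal 1 Rlt_0_1); intros t Ht Ht0.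
    unfold ball in Ht; simpl in Ht; unfold AbsRing_ball, abs, minus, plus, opp in Ht;
      simpl in Ht.
    rewrite Ropp_0, Rplus_0_r, Rabs_pos_eq in Ht by lra.
    assert (Rpower t x <= t).
    { rewrite <- (exp_ln t) at 2 by easy; unfold Rpower; apply exp_monotone.
      assert (ln t <= 0) by (rewrite <- ln_1; apply ln_le; lra); nra. }
    assert (exp (- t) <= 1) by (rewrite <- exp_0; apply exp_monotone; lra).
    pose proof (exp_pos (- t)); assert (0 < Rpower t x) by apply exp_pos; nra.
  - apply filterlim_const.
  - apply (filterlim_filter_le_1 (F := locally 0) (G := at_right 0)); [| apply filterlim_id].
    apply filter_le_within.
Qed.

Lemma gamma_boundary_p_infty (x : R) :
  0 <= x ->
  filterlim (fun t => Rpower t x * exp (- t)) (Rbar_locally p_infty) (locally 0).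
Proof.
  intros Hx; destruct (gamma_kernel_bound x Hx) as (K & HK & Hb).
  apply (filterlim_le_le (fun _ => 0) _ (fun t => K * exp (- t / 2)) 0).
  - exists 0; intros t Ht; split; [| now apply Hb].
    apply Rmult_le_pos; left; apply exp_pos.
  - apply filterlim_const.
  - apply filterlim_exp_half_p_infty.
Qed.

(** Integration by parts: the difference [g] of the two integrands is the derivative of t^x exp(-t),
    which vanishes at both ends, so [g] has integral 0. *)
Lemma Gamma_S (x : R) : 1 <= x -> Gamma (x + 1) = x * Gamma x.
Proof.
  intros Hx.
  set (g := fun t : R => minus (scal x (Rpower t (x - 1) * exp (- t)))
                               (Rpower t x * exp (- t))).
  assert (H1 : is_RInt_gen g (at_right 0) (Rbar_locally p_infty)
                 (minus (scal x (Gamma x)) (Gamma (x + 1)))).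
  { apply (is_RInt_gen_minus (V := R_NormedModule)).
    - apply (is_RInt_gen_scal (V := R_NormedModule)); now apply is_RInt_gen_Gamma.
    - destruct (is_RInt_gen_Gamma (x + 1)) as [H _]; [lra |].
      replace (x + 1 - 1) with x in H by ring; exact H. }
  assert (H2 : is_RInt_gen g (at_right 0) (Rbar_locally p_infty) (0 - 0)).
  { apply (is_RInt_gen_antiderivative (fun t => Rpower t x * exp (- t))).
    - intros t Ht; unfold g, minus, plus, opp, scal; simpl; unfold mult; simpl.
      replace (Rpower t (x - 1)) with (Rpower t x / t).
      + unfold Rpower; auto_derive; [easy |]. field; lra.
      + unfold Rminus; rewrite Rpower_plus, Rpower_Ropp, Rpower_1 by easy; easy.
    - intros t Ht; apply (continuous_minus (V := R_NormedModule));
        [apply (continuous_scal_r (V := R_NormedModule)) |];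
        now apply continuous_gamma_kernel.
    - now apply gamma_boundary_0.
    - apply gamma_boundary_p_infty; lra. }
  apply (is_RInt_gen_unique (V := R_CompleteNormedModule)) in H1.
  apply (is_RInt_gen_unique (V := R_CompleteNormedModule)) in H2.
  rewrite H1 in H2; unfold minus, plus, opp, scal in H2; simpl in H2;
    unfold mult in H2; simpl in H2; lra.
Qed.

Lemma Gamma_1 : Gamma 1 = 1.
Proof.
  unfold Gamma; apply is_RInt_gen_unique; [typeclasses eauto .. |].
  enough (H : is_RInt_gen (fun t => Rpower t (1 - 1) * exp (- t))
                (at_right 0) (Rbar_locally p_infty) (0 - - 1))
    by (replace (0 - - 1) with 1 in H by ring; exact H).
  apply (is_RInt_gen_antiderivative (fun t => - exp (- t))).
  - intros t Ht; replace (1 - 1) with 0 by ring; rewrite Rpower_O by easy.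
    auto_derive; [easy | ring].
  - intros t Ht; now apply continuous_gamma_kernel.
  - replace (- 1) with (- exp (- 0)) by (rewrite Ropp_0, exp_0; ring).
    apply (filterlim_filter_le_1 (F := locally 0) (G := at_right 0));
      [apply filter_le_within |].
    apply (ex_derive_continuous (K := R_AbsRing) (V := R_NormedModule) (fun t => - exp (- t)) 0).
    auto_derive; easy.
  - replace 0 with (- 0) by ring.
    apply filterlim_comp with (G := locally 0);
      [| apply (filterlim_opp (V := R_NormedModule))].
    eapply filterlim_comp; [| exact is_lim_exp_m].
    intros P [M HM]; exists (- M); intros t Ht; apply HM; lra.
Qed.

(** * The coefficients and the radius *)

Lemma Series_zero (a : nat -> R) : (forall n, a n = 0) -> Series a = 0.
Proof.
  intros Ha; rewrite (Series_ext a (fun n => 0 * a n)).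
  - rewrite Series_scal_l; ring.
  - intros n; rewrite Ha; ring.
Qed.

Lemma frac_coef_0 (alpha : R) : frac_coef alpha 0 = 1 / Gamma (1 + alpha).
Proof.
  unfold frac_coef; simpl INR; rewrite Rplus_0_l, Gamma_1.
  now replace (0 + alpha + 1) with (1 + alpha) by ring.
Qed.

(** The functional equation of [Gamma] in numerator and denominator; the monotonicity and the
    numerical bounds below rest on this ratio. *)
Lemma frac_coef_S (alpha : R) (n : nat) :
  0 < alpha ->
  frac_coef alpha (S n) = frac_coef alpha n * ((INR n + 1) / (INR n + 1 + alpha)).
Proof.
  intros Ha; pose proof (pos_INR n); unfold frac_coef; rewrite S_INR.
  replace (INR n + 1 + alpha + 1) with ((INR n + alpha + 1) + 1) by ring.
  rewrite (Gamma_S (INR n + 1)), (Gamma_S (INR n + alpha + 1)) by lra.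
  pose proof (Gamma_pos (INR n + alpha + 1)).
  field; repeat split; lra.
Qed.

Lemma frac_coef_pos (alpha : R) (n : nat) : 0 < alpha -> 0 < frac_coef alpha n.
Proof.
  intros Ha; pose proof (pos_INR n); unfold frac_coef.
  apply Rdiv_lt_0_compat; apply Gamma_pos; lra.
Qed.

Lemma frac_coef_le (alpha : R) (n : nat) :
  0 < alpha -> frac_coef alpha n <= frac_coef alpha 0.
Proof.
  intros Ha; induction n as [| n IH]; [apply Rle_refl |].
  apply Rle_trans with (2 := IH); rewrite frac_coef_S by easy.
  pose proof (pos_INR n); pose proof (frac_coef_pos alpha n Ha).
  rewrite <- (Rmult_1_r (frac_coef alpha n)) at 2.
  apply Rmult_le_compat_l; [lra |].
  apply Rmult_le_reg_r with (INR n + 1 + alpha); [lra |].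
  field_simplify; lra.
Qed.

Lemma ex_series_frac_coef (alpha r : R) :
  0 < alpha -> 0 <= r < 1 -> ex_series (fun n => frac_coef alpha (S n) * r ^ S n).
Proof.
  intros Ha Hr.
  apply (ex_series_le (K := R_AbsRing) (V := R_CompleteNormedModule) _
           (fun n => frac_coef alpha 0 * r ^ S n)).
  - intros n; unfold norm; simpl norm; unfold abs; simpl abs.
    assert (0 <= r ^ S n) by (apply pow_le; lra).
    pose proof (frac_coef_pos alpha (S n) Ha).
    rewrite Rabs_pos_eq by (apply Rmult_le_pos; lra).
    apply Rmult_le_compat_r; [easy | now apply frac_coef_le].
  - apply (ex_series_scal (K := R_AbsRing) (V := R_NormedModule)).
    apply -> (ex_series_incr_1 (fun n => r ^ n)).
    exists (/ (1 - r)); apply is_series_geom; rewrite Rabs_pos_eq; lra.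
Qed.

(** After a factor r is taken out, this is a power series with bounded coefficients, hence of radius
    at least 1. *)
Lemma continuity_frac_coef_series (alpha r : R) :
  0 < alpha -> 0 <= r < 1 ->
  continuity_pt (fun r => Series (fun n => frac_coef alpha (S n) * r ^ S n)) r.
Proof.
  intros Ha Hr.
  apply continuity_pt_ext with
    (fun r => r * PSeries (fun n => frac_coef alpha (S n)) r).
  - intros x; unfold PSeries; rewrite <- Series_scal_l; apply Series_ext.
    intros n; simpl; ring.
  - apply continuity_pt_mult; [apply continuity_pt_id |].
    apply PSeries_continuity; rewrite Rabs_pos_eq by lra.
    apply Rbar_lt_le_trans with 1; [simpl; lra |].
    apply CV_radius_bounded; exists (frac_coef alpha 0); intros n.
    rewrite pow1, Rmult_1_r, Rabs_pos_eq; [now apply frac_coef_le |].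
    left; now apply frac_coef_pos.
Qed.

Lemma ex_radius_root (alpha : R) : 0 < alpha < 1 -> exists r, is_radius_root alpha r.
Proof.
  intros Ha.
  pose proof (frac_coef_pos alpha 0 ltac:(lra)) as H0.
  set (G := fun r => Series (fun n => frac_coef alpha (S n) * r ^ S n)).
  assert (Hhalf : 1 / (2 * Gamma (1 + alpha)) = frac_coef alpha 0 / 2).
  { rewrite frac_coef_0; pose proof (Gamma_pos (1 + alpha)); field; lra. }
  destruct (IVT_interv (fun r => G r - frac_coef alpha 0 / 2) 0 (9 / 10))
    as (r & Hr & HGr).
  - intros a H; apply continuity_pt_minus.
    + apply continuity_frac_coef_series; lra.
    + apply continuity_pt_const; intros x y; easy.
  - lra.
  - unfold G; rewrite Series_zero by (intros n; simpl; ring); lra.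
  (* Since alpha < 1, c_1 >= c_0/2 and c_2 >= (2/3) c_1, so at 9/10 two terms give at least (9/10 +
     27/50) c_0/2 = 0.72 c_0. The first term alone guarantees only 0.45 c_0. *)
  - unfold G; rewrite Series_incr_1 by (apply ex_series_frac_coef; lra).
    rewrite Series_incr_1
      by (apply -> (ex_series_incr_1 (fun n => frac_coef alpha (S n) * (9 / 10) ^ S n));
          apply ex_series_frac_coef; lra).
    assert (0 <= Series (fun n => frac_coef alpha (S (S (S n))) * (9 / 10) ^ S (S (S n)))).
    { rewrite <- (Series_zero (fun _ => 0)) by easy; apply Series_le.
      - intros n; split; [lra |].
        apply Rmult_le_pos; [left; apply frac_coef_pos; lra | apply pow_le; lra].
      - apply (ex_series_incr_n (fun n => frac_coef alpha (S n) * (9 / 10) ^ S n) 2).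
        apply ex_series_frac_coef; lra. }
    assert (frac_coef alpha 0 / 2 <= frac_coef alpha 1).
    { rewrite frac_coef_S by lra; simpl INR; apply Rmult_le_compat_l; [lra |].
      apply Rmult_le_reg_r with (0 + 1 + alpha); [lra |]; field_simplify; lra. }
    assert (frac_coef alpha 1 * (2 / 3) <= frac_coef alpha 2).
    { rewrite (frac_coef_S alpha 1) by lra; simpl INR; apply Rmult_le_compat_l; [lra |].
      apply Rmult_le_reg_r with (1 + 1 + alpha); [lra |]; field_simplify; lra. }
    simpl pow in *; lra.
  (* The intermediate value theorem allows the endpoint 0, where the series vanishes. *)
  - assert (Hr0 : r <> 0).
    { intros ->; unfold G in HGr.
      rewrite Series_zero in HGr by (intros n; simpl; ring); lra. }
    exists r; split; [lra |].
    rewrite Hhalf; replace (frac_coef alpha 0 / 2) with (G r) by lra.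
    apply Series_correct, ex_series_frac_coef; lra.
Qed.

(* Scaling a root [r] by [s / r < 1] scales the series by at most that factor. *)
Lemma radius_root_le (alpha r s : R) :
  0 < alpha -> is_radius_root alpha r -> is_radius_root alpha s -> r <= s.
Proof.
  intros Ha [Hr Sr] [Hs Ss]; apply Rnot_lt_le; intros Hlt.
  pose proof (Gamma_pos (1 + alpha) ltac:(lra)) as HG.
  set (v := 1 / (2 * Gamma (1 + alpha))) in *.
  assert (Hv : 0 < v) by (apply Rdiv_lt_0_compat; lra).
  assert (Hsr : s / r < 1).
  { apply Rmult_lt_reg_r with r; [lra |]; field_simplify; lra. }
  assert (v <= s / r * v).
  { rewrite <- (is_series_unique _ _ Ss) at 1; rewrite <- (is_series_unique _ _ Sr).
    rewrite <- Series_scal_l; apply Series_le.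
    - intros n; pose proof (frac_coef_pos alpha (S n) Ha).
      assert (0 <= s ^ n) by (apply pow_le; lra).
      assert (s ^ n <= r ^ n) by (apply pow_incr; lra).
      split; [apply Rmult_le_pos; [lra | apply pow_le; lra] |].
      replace (s / r * (frac_coef alpha (S n) * r ^ S n))
        with (frac_coef alpha (S n) * (s * r ^ n)) by (simpl; field; lra).
      simpl; apply Rmult_le_compat_l; [lra | apply Rmult_le_compat_l; lra].
    - apply (ex_series_scal (K := R_AbsRing) (V := R_NormedModule)); now exists v. }
  nra.
Qed.

(** [radius_root_le] compares any two roots in either order, so the root is unique and therefore
    minimal. *)
Lemma ex_radius_int (alpha : R) : 0 < alpha < 1 -> exists r, is_radius_int alpha r.
Proof.
  intros Ha; destruct (ex_radius_root alpha Ha) as [r Hr].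
  exists r; split; [exact Hr |].
  intros s Hs; apply (radius_root_le alpha); [lra | easy ..].
Qed.

(** The real-variable end of the argument, with b_n standing for |a_n| and the factor r^alpha
    removed. Terms of positive index are compared with 1 - b_0^2 times the series that defines the
    radius. *)
Lemma bohr_sum_le (alpha r : R) (b : nat -> R) :
  0 < alpha -> 0 <= r < 1 ->
  Series (fun n => frac_coef alpha (S n) * r ^ S n) <= frac_coef alpha 0 / 2 ->
  (forall n, 0 <= b n) -> (forall n, b (S n) <= 1 - b 0%nat ^ 2) ->
  let u := fun n => frac_coef alpha n * b n * r ^ n in
  ex_series u /\ Series u <= frac_coef alpha 0.
Proof.
  intros Ha Hr Hhalf Hb Hbn u.
  pose proof (frac_coef_pos alpha 0 Ha) as H0.
  assert (HA2 : 0 <= 1 - b 0%nat ^ 2) by (apply Rle_trans with (b 1%nat); auto).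
  set (w := fun n => (1 - b 0%nat ^ 2) * (frac_coef alpha (S n) * r ^ S n)).
  assert (Hw : ex_series w).
  { apply (ex_series_scal (K := R_AbsRing) (V := R_NormedModule)).
    now apply ex_series_frac_coef. }
  assert (Huw : forall n, 0 <= u (S n) <= w n).
  { intros n; unfold u, w; pose proof (frac_coef_pos alpha (S n) Ha).
    assert (0 <= r ^ S n) by (apply pow_le; lra).
    assert (0 <= frac_coef alpha (S n) * r ^ S n) by (apply Rmult_le_pos; lra).
    replace (frac_coef alpha (S n) * b (S n) * r ^ S n)
      with (b (S n) * (frac_coef alpha (S n) * r ^ S n)) by ring.
    split; [now apply Rmult_le_pos | now apply Rmult_le_compat_r]. }
  assert (Hu : ex_series u).
  { apply ex_series_incr_1.
    apply (ex_series_le (K := R_AbsRing) (V := R_CompleteNormedModule) _ w); [| easy].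
    intros n; change (Rabs (u (S n)) <= w n); rewrite Rabs_pos_eq; apply Huw. }
  split; [exact Hu |].
  rewrite Series_incr_1 by exact Hu.
  assert (Series (fun n => u (S n)) <= (1 - b 0%nat ^ 2) * (frac_coef alpha 0 / 2)).
  { apply Rle_trans with (Series w); [now apply Series_le |].
    unfold w; rewrite Series_scal_l; now apply Rmult_le_compat_l. }
  apply Rle_trans with (frac_coef alpha 0 * b 0%nat * r ^ 0
                        + (1 - b 0%nat ^ 2) * (frac_coef alpha 0 / 2)).
  - unfold u at 1; now apply Rplus_le_compat_l.
  (* The inequality b_0 + (1 - b_0^2)/2 <= 1 is (1 - b_0)^2 >= 0. *)
  - assert (0 <= frac_coef alpha 0 * (1 - b 0%nat) ^ 2).
    { apply Rmult_le_pos; [lra | apply pow2_ge_0]. }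
    simpl pow in *; lra.
Qed.

(** * Means over roots of unity *)

(** Exactly n terms, which suits means over N points, whereas [sum_n] includes the index n. *)
Fixpoint Csum (u : nat -> C) (n : nat) : C :=
  match n with
  | O => 0
  | S n => Csum u n + u n
  end%C.

Lemma Csum_ext (u v : nat -> C) (n : nat) :
  (forall k, (k < n)%nat -> u k = v k) -> Csum u n = Csum v n.
Proof.
  induction n as [| n IH]; intros H; [easy |]; simpl.
  rewrite IH, H; [easy | lia |]; intros k Hk; apply H; lia.
Qed.

Lemma Csum_plus (u v : nat -> C) (n : nat) :
  Csum (fun k => u k + v k)%C n = (Csum u n + Csum v n)%C.
Proof. induction n as [| n IH]; simpl; [| rewrite IH]; ring. Qed.

Lemma Csum_scal (c : C) (u : nat -> C) (n : nat) :
  Csum (fun k => c * u k)%C n = (c * Csum u n)%C.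
Proof. induction n as [| n IH]; simpl; [| rewrite IH]; ring. Qed.

Lemma Csum_const (c : C) (n : nat) : Csum (fun _ => c) n = (INR n * c)%C.
Proof.
  induction n as [| n IH]; [simpl; ring |].
  rewrite S_INR, RtoC_plus; simpl Csum; rewrite IH; ring.
Qed.

Lemma Csum_Re_nonneg (u : nat -> C) (n : nat) :
  (forall k, (k < n)%nat -> 0 <= Re (u k)) -> 0 <= Re (Csum u n).
Proof.
  induction n as [| n IH]; intros H; [simpl; lra |].
  assert (0 <= Re (Csum u n)) by (apply IH; intros k Hk; apply H; lia).
  pose proof (H n ltac:(lia)); simpl; unfold Re in *; lra.
Qed.

(** The index [k] is an integer so that negative frequencies, which meet no term, are covered
    too. *)
Lemma Csum_indicator (c : nat -> C) (k : Z) (n : nat) :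
  Csum (fun m => if (Z.of_nat m =? k)%Z then c m else 0) n
  = if ((0 <=? k) && (k <? Z.of_nat n))%Z%bool then c (Z.to_nat k) else 0.
Proof.
  induction n as [| n IH]; simpl Csum.
  - destruct (Z.leb_spec 0 k), (Z.ltb_spec k (Z.of_nat 0)); simpl; (easy || lia).
  - rewrite IH.
    destruct (Z.leb_spec 0 k), (Z.ltb_spec k (Z.of_nat n)),
      (Z.ltb_spec k (Z.of_nat (S n))), (Z.eqb_spec (Z.of_nat n) k);
      simpl; (lia || (try ring)).
    subst k; rewrite Nat2Z.id; ring.
Qed.

Lemma Csum_sum_n (u : nat -> C) (n : nat) :
  sum_n (G := C_NormedModule) u n = Csum u (S n).
Proof.
  induction n as [| n IH].
  - rewrite sum_O; simpl; symmetry; apply Cplus_0_l.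
  - now rewrite sum_Sn, IH.
Qed.

Definition cis (t : R) : C := (cos t, sin t).

Lemma cis_plus (s t : R) : cis (s + t) = (cis s * cis t)%C.
Proof.
  unfold cis, Cmult; simpl; rewrite cos_plus, sin_plus; f_equal; ring.
Qed.

Lemma cis_0 : cis 0 = 1.
Proof. unfold cis; now rewrite cos_0, sin_0. Qed.

Lemma Cconj_cis (t : R) : Cconj (cis t) = cis (- t).
Proof. unfold cis, Cconj; simpl; now rewrite cos_neg, sin_neg. Qed.

Lemma Cmod_cis (t : R) : Cmod (cis t) = 1.
Proof.
  unfold Cmod, cis; simpl fst; simpl snd; rewrite <- !Rsqr_pow2, Rplus_comm, sin2_cos2.
  apply sqrt_1.
Qed.

Lemma Cpow_cis (t : R) (n : nat) : (cis t ^ n)%C = cis (INR n * t).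
Proof.
  induction n as [| n IH]; [simpl INR; rewrite Rmult_0_l, cis_0; easy |].
  rewrite Cpow_S, IH, S_INR, <- cis_plus; f_equal; ring.
Qed.

Lemma cis_2PI_Z (k : Z) : cis (2 * PI * IZR k) = 1.
Proof.
  assert (Hn : forall n : nat, cis (2 * PI * INR n) = 1).
  { intros n; rewrite Rmult_comm, <- Cpow_cis.
    unfold cis; rewrite cos_2PI, sin_2PI; apply Cpow_1_l. }
  destruct (Z_le_gt_dec 0 k) as [Hk | Hk].
  - rewrite <- (Z2Nat.id k) by easy; rewrite <- INR_IZR_INZ; apply Hn.
  - replace (2 * PI * IZR k) with (- (2 * PI * INR (Z.to_nat (- k)))).
    + rewrite <- Cconj_cis, Hn; unfold Cconj; simpl; unfold RtoC; f_equal; ring.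
    + rewrite INR_IZR_INZ, Z2Nat.id, opp_IZR by lia; ring.
Qed.

(** Here cos t = 1 - 2 sin^2(|t|/2), and the sine is positive because |t|/2 lies strictly between 0
    and pi. *)
Lemma cis_ne_1 (t : R) : 0 < Rabs t < 2 * PI -> cis t <> 1.
Proof.
  intros Ht H; assert (Hc : cos t = 1) by (unfold cis in H; now injection H).
  assert (Hc' : cos (Rabs t) = 1).
  { unfold Rabs; destruct (Rcase_abs t); [now rewrite cos_neg | easy]. }
  replace (Rabs t) with (2 * (Rabs t / 2)) in Hc' by field.
  rewrite cos_2a_sin in Hc'.
  assert (0 < sin (Rabs t / 2)) by (apply sin_gt_0; lra).
  nra.
Qed.

(** Orthogonality of characters. For k <> 0 this is a geometric sum: multiplied by its ratio minus 1
    it telescopes to cis(2 pi k) - 1 = 0, and |k| < N keeps the ratio away from 1. *)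
Lemma Csum_cis (N : nat) (k : Z) :
  (Z.abs k < Z.of_nat N)%Z ->
  Csum (fun j => cis (INR j * (2 * PI * IZR k / INR N))) N
  = if (k =? 0)%Z then RtoC (INR N) else 0.
Proof.
  intros Hk.
  assert (HN : 0 < INR N) by (apply lt_0_INR; lia).
  destruct (Z.eqb_spec k 0) as [-> | Hk0].
  - rewrite (Csum_ext _ (fun _ => 1)), Csum_const; [ring |].
    intros j _; rewrite <- cis_0; f_equal; field; lra.
  - set (phi := 2 * PI * IZR k / INR N).
    assert (Hgeom : forall n, ((cis phi - 1) * Csum (fun j => cis (INR j * phi)) n
                               = cis (INR n * phi) - 1)%C).
    { induction n as [| n IH]; [simpl INR; rewrite Rmult_0_l, cis_0; simpl; ring |].
      simpl Csum; rewrite Cmult_plus_distr_l, IH, S_INR.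
      replace ((INR n + 1) * phi) with (phi + INR n * phi) by ring.
      rewrite cis_plus; ring. }
    assert (Hphi : cis phi <> 1).
    { apply cis_ne_1; unfold phi, Rdiv.
      pose proof PI_RGT_0.
      assert (0 < IZR (Z.abs k)) by (apply IZR_lt; lia).
      assert (IZR (Z.abs k) < INR N) by (rewrite INR_IZR_INZ; now apply IZR_lt).
      assert (0 < / INR N) by now apply Rinv_0_lt_compat.
      rewrite !Rabs_mult, <- (abs_IZR k), (Rabs_pos_eq 2), (Rabs_pos_eq PI),
        (Rabs_pos_eq (/ INR N)) by lra.
      split; [apply Rmult_lt_0_compat; [apply Rmult_lt_0_compat |]; lra |].
      apply Rmult_lt_reg_r with (INR N); [easy |].
      rewrite Rmult_assoc, Rinv_l, Rmult_1_r by lra.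
      apply Rmult_lt_compat_l; lra. }
    assert (Hd : (cis phi - 1)%C <> 0).
    { intros H; apply Hphi; rewrite <- (Cplus_0_l 1), <- H; ring. }
    rewrite <- (Cmult_1_l (Csum _ _)), <- (Cinv_l _ Hd), <- Cmult_assoc, Hgeom.
    replace (INR N * phi) with (2 * PI * IZR k) by (unfold phi; field; lra).
    rewrite cis_2PI_Z; ring.
Qed.

(** Discrete Fourier coefficients of a polynomial are exact when no two frequencies involved agree
    modulo N; the hypothesis on |m - k| excludes this aliasing. Linearity reduces the claim to
    monomials, added one at a time. *)
Lemma polynomial_mean (a : nat -> C) (rho : R) (M N : nat) (k : Z) :
  (forall m, (m < M)%nat -> Z.abs (Z.of_nat m - k) < Z.of_nat N)%Z ->
  Csum (fun j =>
      Csum (fun m => a m * (rho * cis (INR j * (2 * PI / INR N))) ^ m)%C M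
      * cis (- (INR j * (2 * PI * IZR k / INR N))))%C N
  = (INR N * (if ((0 <=? k) && (k <? Z.of_nat M))%Z%bool
              then a (Z.to_nat k) * rho ^ Z.to_nat k else 0))%C.
Proof.
  rewrite <- (Csum_indicator (fun m => a m * rho ^ m)%C).
  induction M as [| M IH]; intros HM; simpl Csum.
  - rewrite (Csum_ext _ (fun _ => 0)) by (intros; ring); rewrite Csum_const; ring.
  - rewrite Cmult_plus_distr_l, <- IH by (intros m Hm; apply HM; lia).
    assert (Hk : (Z.abs (Z.of_nat M - k) < Z.of_nat N)%Z) by (apply HM; lia).
    assert (HN : 0 < INR N) by (apply lt_0_INR; lia).
    replace (INR N * (if (Z.of_nat M =? k)%Z then a M * rho ^ M else 0))%C
      with (Csum (fun j => (a M * rho ^ M)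
              * cis (INR j * (2 * PI * IZR (Z.of_nat M - k) / INR N))) N)%C.
    + rewrite <- Csum_plus; apply Csum_ext; intros j Hj.
      rewrite Cmult_plus_distr_r; f_equal.
      rewrite Cpow_mult_l, Cpow_cis, <- !Cmult_assoc, <- cis_plus; do 3 f_equal.
      rewrite minus_IZR, <- INR_IZR_INZ; field; lra.
    + rewrite Csum_scal, Csum_cis by exact Hk.
      destruct (Z.eqb_spec (Z.of_nat M - k) 0), (Z.eqb_spec (Z.of_nat M) k);
        (lia || ring).
Qed.

(** * Wiener's coefficient inequality *)

(* Expansion of [0 <= |P u - v|^2 + (K - |P|^2) |u|^2] for [u = s + conj(x) b e] and
   [v = s x + b e], where [|e| = 1]. *)
Lemma mean_integrand_nonneg (x b P e : C) (s K : R) :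
  Cmod e = 1 -> Cmod P ^ 2 <= K ->
  0 <= Re (RtoC (K * (s ^ 2 + Cmod x ^ 2 * Cmod b ^ 2)
                 + (Cmod x ^ 2 * s ^ 2 + Cmod b ^ 2))
           + RtoC (2 * (K + 1) * s) * Cconj x * b * e
           + RtoC (- 2) * ((RtoC (s ^ 2 + Cmod b ^ 2) * Cconj x) * P
                           + RtoC s * Cconj b * (P * Cconj e)
                           + Cconj x ^ 2 * b * RtoC s * (P * e)))%C.
Proof.
  intros He HP.
  assert (He2 : fst e ^ 2 + snd e ^ 2 = 1)
    by (change (Re e ^ 2 + Im e ^ 2 = 1); rewrite <- Cmod2_alt, He; ring).
  rewrite Cmod2_alt in HP; rewrite !Cmod2_alt.
  destruct x as [x y], b as [g h], P as [p q], e as [c d].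
  unfold Re, Im in *; simpl in *.
  set (u1 := s + (x * g + y * h) * c - (x * h - y * g) * d).
  set (u2 := (x * g + y * h) * d + (x * h - y * g) * c).
  set (v1 := s * x + g * c - h * d).
  set (v2 := s * y + g * d + h * c).
  assert (H : 0 <= (p * u1 - q * u2 - v1) ^ 2 + (p * u2 + q * u1 - v2) ^ 2
                   + (K - (p * (p * 1) + q * (q * 1))) * (u1 ^ 2 + u2 ^ 2)).
  { pose proof (pow2_ge_0 (p * u1 - q * u2 - v1)).
    pose proof (pow2_ge_0 (p * u2 + q * u1 - v2)).
    pose proof (pow2_ge_0 u1); pose proof (pow2_ge_0 u2).
    assert (0 <= (K - (p * (p * 1) + q * (q * 1))) * (u1 ^ 2 + u2 ^ 2))
      by (apply Rmult_le_pos; lra).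
    lra. }
  match goal with |- 0 <= ?T => set (t := T) end.
  (* The expansion is an identity only modulo |e| = 1; the remainder is the added multiple of 1 -
     |e|^2, which [He2] cancels. *)
  match type of H with 0 <= ?W =>
    replace t with (W + (1 - (c * (c * 1) + d * (d * 1)))
      * (K * (x ^ 2 + y ^ 2) * (g ^ 2 + h ^ 2) + (g ^ 2 + h ^ 2)
         - 2 * ((g ^ 2 + h ^ 2) * (x * p + y * q)))) end.
  - rewrite He2; lra.
  - unfold t, u1, u2, v1, v2; ring.
Qed.

(** Summing [mean_integrand_nonneg] over the N points leaves only the sums prescribed by the
    hypotheses. They say that P has mean x, coefficient b at the frequency conjugate to e, and none
    at the opposite one. *)
Lemma finite_wiener (x b : C) (P e : nat -> C) (N : nat) (K : R) :
  (0 < N)%nat ->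
  (forall j, Cmod (e j) = 1) ->
  (forall j, Cmod (P j) ^ 2 <= K) ->
  Csum e N = 0 ->
  Csum P N = (INR N * x)%C ->
  Csum (fun j => P j * Cconj (e j))%C N = (INR N * b)%C ->
  Csum (fun j => P j * e j)%C N = 0 ->
  let s := 1 - Cmod x ^ 2 in
  Cmod x ^ 2 * s ^ 2 + Cmod b ^ 2 <= K * (s ^ 2 + Cmod x ^ 2 * Cmod b ^ 2).
Proof.
  intros HN He HP H0 Hx Hb HPe s.
  pose proof (Csum_Re_nonneg _ N
    (fun j _ => mean_integrand_nonneg x b (P j) (e j) s K (He j) (HP j))) as H.
  rewrite !Csum_plus, Csum_const, !Csum_scal, !Csum_plus, !Csum_scal in H.
  rewrite H0, Hx, Hb, HPe in H.
  set (X := Cmod x ^ 2) in *; set (B := Cmod b ^ 2) in *.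
  assert (HX : (Cconj x * x)%C = RtoC X)
    by (unfold X; rewrite Cmod2_conj; ring).
  assert (HB : (Cconj b * b)%C = RtoC B)
    by (unfold B; rewrite Cmod2_conj; ring).
  replace (RtoC (s ^ 2 + B) * Cconj x * (INR N * x))%C
    with (RtoC (INR N * ((s ^ 2 + B) * X))) in H
    by (rewrite !RtoC_mult, <- HX; ring).
  replace (RtoC s * Cconj b * (INR N * b))%C
    with (RtoC (INR N * (s * B))) in H
    by (rewrite !RtoC_mult, <- HB; ring).
  unfold Re in H; simpl in H.
  assert (HN' : 0 < INR N) by now apply lt_0_INR.
  apply Rmult_le_reg_l with (INR N); [easy |].
  assert (s = 1 - X) by easy; clearbody s X B.
  (* The choice of s enters here: X + s = 1 merges the two cross terms into the mean of |v|^2. *)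
  assert (INR N * ((s ^ 2 + B) * X) + INR N * (s * B) = INR N * (X * s ^ 2 + B))
    by (subst s; ring).
  nra.
Qed.

(** * Taylor polynomials of a function of class B *)

Lemma pow_n_Cpow (z : C) (n : nat) : pow_n (K := C_Ring) z n = (z ^ n)%C.
Proof. induction n as [| n IH]; [easy |]; simpl; now rewrite IH. Qed.

Lemma in_class_B_partial_sums (f : C -> C) (a : nat -> C) (z : C) (eps : R) :
  in_class_B f a -> Cmod z < 1 -> 0 < eps ->
  exists M, forall m, (M <= m)%nat ->
    Cmod (Csum (fun k => a k * z ^ k)%C m - f z) < eps.
Proof.
  intros Hf Hz Heps; destruct (Hf z Hz) as [Hs _].
  apply (proj1 (filterlim_locally_ball_norm _ _)) with (eps := mkposreal eps Heps) in Hs.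
  (* [Csum] with m + 1 terms is [sum_n] up to m, hence the shift by one. *)
  destruct Hs as [M HM]; exists (S M); intros m Hm.
  destruct m as [| m]; [lia |].
  specialize (HM m ltac:(lia)); revert HM; unfold ball_norm; simpl pos.
  rewrite Csum_sum_n.
  rewrite (Csum_ext _ (fun k => a k * z ^ k)%C); [easy |].
  intros k _; rewrite <- pow_n_Cpow; apply Cmult_comm.
Qed.

(** The term a_n rho^n is the difference of two consecutive partial sums, both eventually within 1/2
    of f(rho). *)
Lemma class_B_coef_bounded (f : C -> C) (a : nat -> C) (rho : R) :
  in_class_B f a -> 0 <= rho < 1 ->
  exists N, forall n, (N <= n)%nat -> Cmod (a n) * rho ^ n <= 1.
Proof.
  intros Hf Hrho.
  assert (Hmod : Cmod rho = rho) by (rewrite Cmod_R; apply Rabs_pos_eq; lra).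
  destruct (in_class_B_partial_sums f a rho (1 / 2) Hf) as [N HN]; [lra | lra |].
  exists N; intros n Hn.
  pose proof (HN n Hn) as H1; pose proof (HN (S n) ltac:(lia)) as H2; simpl in H2.
  rewrite <- Hmod, <- Cmod_pow, <- Cmod_mult.
  set (S := Csum _ n) in *.
  replace (a n * rho ^ n)%C with ((S + a n * rho ^ n - f rho) + - (S - f rho))%C by ring.
  apply Rle_trans with (1 := Cmod_triangle _ _); rewrite Cmod_opp; lra.
Qed.

(* The tail is dominated by a geometric series with ratio [rho / rho'] for some
   [rho < rho' < 1], which makes [M] independent of the point of the circle. *)
Lemma class_B_uniform_partial_sums (f : C -> C) (a : nat -> C) (rho eps : R) :
  in_class_B f a -> 0 < rho < 1 -> 0 < eps ->
  exists M, forall m z, (M <= m)%nat -> Cmod z = rho ->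
    Cmod (Csum (fun k => a k * z ^ k)%C m) <= 1 + eps.
Proof.
  intros Hf Hrho Heps.
  set (rho' := (1 + rho) / 2).
  destruct (class_B_coef_bounded f a rho' Hf) as [N HN]; [unfold rho'; lra |].
  set (q := rho / rho').
  assert (Hrho' : 0 < rho') by (unfold rho'; lra).
  assert (Hq0 : 0 < q) by (apply Rdiv_lt_0_compat; lra).
  assert (Hq : q < 1).
  { apply Rmult_lt_reg_r with rho'; [easy |].
    replace (q * rho') with rho by (unfold q; field; lra); unfold rho'; lra. }
  assert (Hterm : forall n, (N <= n)%nat -> Cmod (a n) * rho ^ n <= q ^ n).
  { intros n Hn; replace rho with (rho' * q) by (unfold q; field; lra).
    rewrite Rpow_mult_distr, <- Rmult_assoc; rewrite <- (Rmult_1_l (q ^ n)) at 2.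
    apply Rmult_le_compat_r; [apply pow_le; lra | now apply HN]. }
  (* From [N'] on, the geometric tail q^m / (1 - q) is below eps/2. *)
  destruct (pow_lt_1_zero q ltac:(rewrite Rabs_pos_eq; lra) (eps / 2 * (1 - q)))
    as [N' HN'].
  { apply Rmult_lt_0_compat; lra. }
  exists (max N N'); intros m z Hm Hz.
  set (u := fun k => (a k * z ^ k)%C).
  assert (Htail : forall d,
    Cmod (Csum u (m + d) - Csum u m)%C <= (q ^ m - q ^ (m + d)) / (1 - q)).
  { induction d as [| d IH].
    - rewrite Nat.add_0_r; replace (Csum u m - Csum u m)%C with (RtoC 0) by ring.
      rewrite Cmod_0; unfold Rdiv; lra.
    - rewrite Nat.add_succ_r; simpl Csum.
      replace (Csum u (m + d) + u (m + d)%nat - Csum u m)%C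
        with ((Csum u (m + d) - Csum u m) + u (m + d)%nat)%C by ring.
      apply Rle_trans with (1 := Cmod_triangle _ _).
      assert (Cmod (u (m + d)%nat) <= q ^ (m + d)).
      { unfold u; rewrite Cmod_mult, Cmod_pow, Hz; apply Hterm; lia. }
      replace ((q ^ m - q ^ S (m + d)) / (1 - q))
        with ((q ^ m - q ^ (m + d)) / (1 - q) + q ^ (m + d)) by (simpl; field; lra).
      lra. }
  destruct (in_class_B_partial_sums f a z (eps / 2) Hf) as [L HL]; [lra | lra |].
  specialize (HL (m + L)%nat ltac:(lia)); specialize (Htail L).
  destruct (Hf z) as [_ Hfz]; [lra |].
  assert ((q ^ m - q ^ (m + L)) / (1 - q) <= eps / 2).
  { apply Rmult_le_reg_r with (1 - q); [lra |].
    unfold Rdiv at 1; rewrite Rmult_assoc, Rinv_l, Rmult_1_r by lra.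
    specialize (HN' m ltac:(lia)); rewrite Rabs_pos_eq in HN' by (apply pow_le; lra).
    assert (0 < q ^ (m + L)) by now apply pow_lt.
    lra. }
  fold u in HL; fold u.
  (* The three summands have modulus at most eps/2 (tail), eps/2 (convergence at this z) and 1
     (class B). The index [L] may depend on z, since the tail bound is uniform in it. *)
  replace (Csum u m)
    with ((- (Csum u (m + L) - Csum u m) + (Csum u (m + L) - f z)) + f z)%C by ring.
  apply Rle_trans with (1 := Cmod_triangle _ _).
  pose proof (Cmod_triangle (- (Csum u (m + L) - Csum u m)) (Csum u (m + L) - f z)) as H3.
  rewrite Cmod_opp in H3; lra.
Qed.

(** A long partial sum has modulus at most 1 + d on the circle of radius rho, so [finite_wiener]
    applies with K = (1 + d)^2; then d is made arbitrarily small. *)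
Lemma wiener_radius (f : C -> C) (a : nat -> C) (n : nat) (rho : R) :
  in_class_B f a -> (0 < n)%nat -> 0 < rho < 1 ->
  let s := 1 - Cmod (a 0%nat) ^ 2 in
  let B := Cmod (a n) * rho ^ n in
  Cmod (a 0%nat) ^ 2 * s ^ 2 + B ^ 2 <= s ^ 2 + Cmod (a 0%nat) ^ 2 * B ^ 2.
Proof.
  intros Hf Hn Hrho s B.
  set (Y := s ^ 2 + Cmod (a 0%nat) ^ 2 * B ^ 2).
  assert (HY : 0 <= Y).
  { apply Rplus_le_le_0_compat; [| apply Rmult_le_pos]; apply pow2_ge_0. }
  apply le_epsilon; intros eps Heps.
  (* With d <= 1, (1 + d)^2 <= 1 + 3d, so the excess over Y is at most 3dY <= eps; Y + 1 avoids
     division by 0. *)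
  set (d := Rmin 1 (eps / (3 * (Y + 1)))).
  assert (Hd : 0 < d).
  { apply Rmin_glb_lt; [lra | apply Rdiv_lt_0_compat; lra]. }
  assert (Hd1 : d <= 1) by apply Rmin_l.
  assert (HdY : 3 * d * Y <= eps).
  { assert (d * (3 * (Y + 1)) <= eps).
    { apply Rle_trans with (eps / (3 * (Y + 1)) * (3 * (Y + 1))).
      - apply Rmult_le_compat_r; [lra | apply Rmin_r].
      - right; field; lra. }
    lra. }
  destruct (class_B_uniform_partial_sums f a rho d Hf Hrho Hd) as [M0 HM0].
  (* M > n keeps the term of degree n, and N exceeds |m - k| for all m < M and the three frequencies
     k = 0, n, -n. *)
  set (M := (M0 + n + 1)%nat); set (N := (M + n + 1)%nat).
  assert (HN : 0 < INR N) by (apply lt_0_INR; lia).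
  set (z := fun j => (rho * cis (INR j * (2 * PI / INR N)))%C).
  set (P := fun j => Csum (fun m => a m * z j ^ m)%C M).
  set (e := fun j => cis (INR j * (2 * PI * IZR (Z.of_nat n) / INR N))).
  assert (HB : Cmod (a n * rho ^ n)%C = B).
  { unfold B; rewrite Cmod_mult, Cmod_pow, Cmod_R, Rabs_pos_eq by lra; easy. }
  assert (Hfin : Cmod (a 0%nat) ^ 2 * s ^ 2 + Cmod (a n * rho ^ n)%C ^ 2
                 <= (1 + d) ^ 2 * (s ^ 2 + Cmod (a 0%nat) ^ 2 * Cmod (a n * rho ^ n)%C ^ 2)).
  { apply (finite_wiener (a 0%nat) (a n * rho ^ n)%C P e N).
    - lia.
    - intros j; apply Cmod_cis.
    - intros j; apply pow_incr; split; [apply Cmod_ge_0 |].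
      apply HM0; [lia |].
      unfold z; rewrite Cmod_mult, Cmod_cis, Cmod_R, Rabs_pos_eq by lra; ring.
    - unfold e; rewrite Csum_cis by lia.
      destruct (Z.eqb_spec (Z.of_nat n) 0); [lia | easy].
    - pose proof (polynomial_mean a rho M N 0 ltac:(lia)) as H.
      destruct (Z.leb_spec 0 0), (Z.ltb_spec 0 (Z.of_nat M)); try lia.
      simpl in H; rewrite Cmult_1_r in H; rewrite <- H.
      apply Csum_ext; intros j _; unfold P, z.
      replace (- (INR j * (2 * PI * 0 / INR N))) with 0 by (field; lra).
      rewrite cis_0; ring.
    - pose proof (polynomial_mean a rho M N (Z.of_nat n) ltac:(lia)) as H.
      destruct (Z.leb_spec 0 (Z.of_nat n)), (Z.ltb_spec (Z.of_nat n) (Z.of_nat M)); try lia.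
      simpl andb in H; cbv iota in H; rewrite Nat2Z.id in H; rewrite <- H.
      apply Csum_ext; intros j _; unfold P, z, e; now rewrite Cconj_cis.
    (* A polynomial has no term of negative degree -n, so the mean of P e vanishes. *)
    - pose proof (polynomial_mean a rho M N (- Z.of_nat n) ltac:(lia)) as H.
      destruct (Z.leb_spec 0 (- Z.of_nat n)); try lia.
      simpl andb in H; cbv iota in H; rewrite Cmult_0_r in H; rewrite <- H.
      apply Csum_ext; intros j _; unfold P, z, e; do 2 f_equal.
      rewrite opp_IZR; field; lra. }
  rewrite HB in Hfin; fold Y in Hfin.
  assert ((1 + d) ^ 2 <= 1 + 3 * d) by nra.
  assert ((1 + d) ^ 2 * Y <= (1 + 3 * d) * Y) by now apply Rmult_le_compat_r.
  lra.
Qed.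

Lemma Cmod_coef_0_lt_1 (f : C -> C) (a : nat -> C) :
  in_class_B f a -> Cmod (a 0%nat) < 1.
Proof.
  intros Hf.
  assert (H0 : Cmod 0 < 1) by (rewrite Cmod_0; lra).
  destruct (Hf 0 H0) as [_ Hlt].
  replace (a 0%nat) with (f 0); [easy |].
  enough (H : (f 0 - a 0%nat)%C = 0)
    by (replace (f 0) with (f 0 - a 0%nat + a 0%nat)%C by ring; rewrite H; ring).
  apply Cmod_eq_0.
  apply Rle_antisym; [| apply Cmod_ge_0].
  apply le_epsilon; intros eps Heps.
  destruct (in_class_B_partial_sums f a 0 eps Hf H0 Heps) as [M HM].
  specialize (HM (S M) ltac:(lia)).
  (* At z = 0 only the term of index 0 survives, with 0^0 = 1, so every nonempty partial sum is
     a_0. *)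
  rewrite (Csum_ext _ (fun m => if (Z.of_nat m =? 0)%Z then a m else 0)) in HM.
  - rewrite Csum_indicator in HM.
    destruct (Z.leb_spec 0 0), (Z.ltb_spec 0 (Z.of_nat (S M))); try lia.
    simpl andb in HM; cbv iota in HM; simpl Z.to_nat in HM.
    rewrite <- Cmod_opp.
    replace (- (f 0 - a 0%nat))%C with (a 0%nat - f 0)%C by ring; lra.
  - intros [| k] _; simpl; ring.
Qed.

(** As 1 - |a_0|^2 = s > 0, [wiener_radius] rearranges to s B^2 <= s s^2, hence B <= s for each rho
    < 1; then rho tends to 1. *)
Lemma wiener (f : C -> C) (a : nat -> C) (n : nat) :
  in_class_B f a -> (0 < n)%nat -> Cmod (a n) <= 1 - Cmod (a 0%nat) ^ 2.
Proof.
  intros Hf Hn.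
  pose proof (Cmod_coef_0_lt_1 f a Hf) as H1; pose proof (Cmod_ge_0 (a 0%nat)) as H0.
  set (s := 1 - Cmod (a 0%nat) ^ 2).
  assert (Hs : 0 < s) by (unfold s; nra).
  assert (Hrho : forall rho, 0 < rho < 1 -> Cmod (a n) * rho ^ n <= s).
  { intros rho Hr; pose proof (wiener_radius f a n rho Hf Hn Hr) as H.
    cbv zeta in H; fold s in H; set (B := Cmod (a n) * rho ^ n) in *.
    assert (Cmod (a 0%nat) ^ 2 = 1 - s) by (unfold s; ring).
    apply Rnot_lt_le; intros Hlt; rewrite H2 in H.
    assert (s * s ^ 2 < s * B ^ 2) by (apply Rmult_lt_compat_l; [easy | nra]).
    nra. }
  (* The shift by 2 keeps the radii 1 - 1/(k + 2) strictly between 0 and 1 from k = 0 on. *)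
  apply (is_lim_seq_le (fun k => Cmod (a n) * (1 - / (INR k + 2)) ^ n) (fun _ => s)
           (Cmod (a n)) s).
  - intros k; apply Hrho; pose proof (pos_INR k).
    assert (0 < / (INR k + 2)) by (apply Rinv_0_lt_compat; lra).
    assert (/ (INR k + 2) < 1) by (rewrite <- Rinv_1; apply Rinv_lt_contravar; lra).
    lra.
  - replace (Finite (Cmod (a n))) with (Finite (Cmod (a n) * (1 - 0) ^ n))
      by (f_equal; rewrite Rminus_0_r, pow1; ring).
    apply (is_lim_seq_continuous (fun t => Cmod (a n) * (1 - t) ^ n)).
    + apply derivable_continuous_pt; reg.
    + apply (is_lim_seq_inv _ p_infty); [| easy].
      apply (is_lim_seq_plus _ _ p_infty 2); [apply is_lim_seq_INR | apply is_lim_seq_const | easy].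
  - apply is_lim_seq_const.
Qed.

(** * The Bohr radius *)

(** Existence of the radius keeps the second part from being vacuous. Summability is stated
    separately because [Series] takes a default value on divergent series. *)
Theorem theorem3p9 (alpha : R) (Halpha : 0 < alpha < 1) :
  (exists Rint : R, is_radius_int alpha Rint) /\
  (forall (f : C -> C) (a : nat -> C) (Rint : R),
     in_class_B f a ->
     is_radius_int alpha Rint ->
     forall r : R, 0 < r <= Rint ->
       let u := fun n : nat =>
         frac_coef alpha n * Cmod (a n) * Rpower r (INR n + alpha) in
       ex_series u /\
       Series u <= Rpower r alpha / Gamma (1 + alpha)).
Proof.
  split; [now apply ex_radius_int |].
  intros f a Rint Hf [[HR Hroot] _] r Hr u.
  pose proof (Gamma_pos (1 + alpha) ltac:(lra)) as HG.
  (* The series has positive coefficients, so at r <= [Rint] it is at most its value at the root. *)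
  assert (Hhalf : Series (fun n => frac_coef alpha (S n) * r ^ S n)
                  <= frac_coef alpha 0 / 2).
  { replace (frac_coef alpha 0 / 2) with (1 / (2 * Gamma (1 + alpha)))
      by (rewrite frac_coef_0; field; lra).
    rewrite <- (is_series_unique _ _ Hroot); apply Series_le; [| now eexists; apply Hroot].
    intros n; pose proof (frac_coef_pos alpha (S n) ltac:(lra)).
    split; [apply Rmult_le_pos; [lra | apply pow_le; lra] |].
    apply Rmult_le_compat_l; [lra | apply pow_incr; lra]. }
  destruct (bohr_sum_le alpha r (fun n => Cmod (a n))) as [Hex Hle];
    [lra | lra | exact Hhalf | intros n; apply Cmod_ge_0 | |].
  { intros n; apply (wiener f); [exact Hf | lia]. }
  set (w := fun n => frac_coef alpha n * Cmod (a n) * r ^ n) in *.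
  (* Splitting r^(n + alpha) as r^n r^alpha reduces the claim to [bohr_sum_le]. *)
  assert (Hu : forall n, Rpower r alpha * w n = u n).
  { intros n; unfold u, w; rewrite Rpower_plus, Rpower_pow by lra; ring. }
  split.
  - apply (ex_series_ext (fun n => Rpower r alpha * w n)); [exact Hu |].
    now apply (ex_series_scal (K := R_AbsRing) (V := R_NormedModule)).
  - rewrite <- (Series_ext _ _ Hu), Series_scal_l.
    rewrite frac_coef_0 in Hle.
    replace (Rpower r alpha / Gamma (1 + alpha))
      with (Rpower r alpha * (1 / Gamma (1 + alpha))) by (field; lra).
    apply Rmult_le_compat_l; [left; apply exp_pos | exact Hle].
Qed.
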